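(* Let $T\colon R^{p,0}_\omega\to R^{p,0}_\omega$ be a bounded linear operator, let $M,N\in\mathbb N$ with $M>N$ and $\mathcal B\subseteq\mathcal D^N$. On $\{-1,1\}^{\mathcal B}$ with the uniform probability, let $b(\theta)=\sum_{K\in\mathcal B}\theta_Kh^M_K$ and $Z(\theta)=\langle b(\theta),Tb(\theta)\rangle-\sum_{K\in\mathcal B}\langle h^M_K,Th^M_K\rangle$. Then $\mathbb E(Z)=0$ and $\mathrm{Var}(Z)\le2\|T\|^2\,|\bigcup\mathcal B|^{1/p+1}\,2^{-N/q}$, where $|\bigcup\mathcal B|$ is the Lebesgue measure of the union of the intervals in $\mathcal B$.
   Context: Fix $1<p<\infty$, $q=p/(p-1)$, $p^*=\max\{p,q\}$. All $L_r$ spaces are over $[0,1]$ with Lebesgue measure and $\langle g,f\rangle=\int_0^1gf$. A dyadic interval is $[(i-1)2^{-n},i2^{-n})$, $n\ge0$, $1\le i\le2^n$; $\mathcal D^n$ is the set of those of length $2^{-n}$ and $\mathcal D_n=\bigcup_{k=0}^n\mathcal D^k$. For a dyadic interval $I$, $I^+,I^-$ are its left and right halves and $h_I=\chi_{I^+}-\chi_{I^-}$. For each $n\in\mathbb N$ a family $(h^n_I)_{I\in\mathcal D_{n-1}}$ in $L_p$ is fixed with the same joint distribution as $(h_I)_{I\in\mathcal D_{n-1}}$, such that the $\sigma$-algebras $\sigma(h^n_I:I\in\mathcal D_{n-1})$, $n\in\mathbb N$, are independent. Let $\mathcal D_\omega=\{(n,I):n\in\mathbb N,I\in\mathcal D_{n-1}\}$,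 linearly ordered by $(m,J)\prec(n,I)$ iff $m<n$, or $m=n$ and $J$ precedes $I$ in $\mathcal D_{m-1}$ (intervals ordered first by level, coarser first, then from left to right). $R^{p,0}_\omega$ is the closed linear span of $\{h^n_I:(n,I)\in\mathcal D_\omega\}$ in $L_p$ (a distributional copy of the mean-zero hyperplane of the Bourgain–Rosenthal–Schechtman space $R^p_\omega$); $(h^n_I)_{(n,I)\in\mathcal D_\omega}$, in the order $\prec$, is an unconditional basis of it. *)

(* Defs.v *)
From HB Require Import structures.
From mathcomp Require Import all_boot all_order all_algebra.
From mathcomp Require Import all_classical all_reals all_analysis.
Set Implicit Arguments. Unset Strict Implicit. Unset Printing Implicit Defensive.
Import Order.TTheory GRing.Theory Num.Theory.
Local Open Scope classical_set_scope.
Local Open Scope ring_scope.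

Section Defs.
Variable R : realType.

Definition lam := (@lebesgue_measure R).
Definition unitI : set R := `[0%R, 1%R]%classic.

(* dyadic interval of level k and (0-based) position i < 2^k :
   [i 2^-k, (i+1) 2^-k) *)
Definition dint (k i : nat) : set R :=
  `[ (i%:R / (2 ^ k)%:R), (i.+1%:R / (2 ^ k)%:R) [%classic.

Definition haar (k i : nat) : R -> R :=
  fun x => \1_(dint k.+1 i.*2) x - \1_(dint k.+1 i.*2.+1) x.

Definition Lp_int (p : R) (f : R -> R) : \bar R :=
  (\int[lam]_(x in unitI) ((`|f x| `^ p)%:E))%E.
Definition inLp (p : R) (f : R -> R) : Prop :=
  measurable_fun setT f /\ (Lp_int p f < +oo)%E.
Definition Lpnorm (p : R) (f : R -> R) : R := (fine (Lp_int p f)) `^ p^-1.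

Definition ip (g f : R -> R) : R := fine (\int[lam]_(x in unitI) (g x * f x)%:E)%E.

(* A family h n k i stands for h^n_I with I = dint k i;
   valid indices: n >= 1, I in D_{n-1} (i.e. k <= n-1), i < 2^k. *)
Definition vidx (t : nat * nat * nat) : bool :=
  [&& (0 < t.1.1)%N, (t.1.2 < t.1.1)%N & (t.2 < 2 ^ t.1.2)%N].

Definition hsig (h : nat -> nat -> nat -> R -> R) (n : nat) : set (set R) :=
  <<s [set E | exists k i (A : set R),
          vidx (n, k, i) /\ measurable A /\ E = h n k i @^-1` A] >>.

Definition haar_copies (h : nat -> nat -> nat -> R -> R) : Prop :=
  (forall n k i, vidx (n, k, i) -> measurable_fun setT (h n k i)) /\
  (* (h^n_I)_{I in D_{n-1}} has the same joint distribution as (h_I)_{I in D_{n-1}} *)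
  (forall n, (0 < n)%N -> forall A : nat -> nat -> set R,
     (forall k i, measurable (A k i)) ->
     lam (unitI `&` [set x | forall k i, (k < n)%N -> (i < 2 ^ k)%N -> A k i (h n k i x)])
     = lam (unitI `&` [set x | forall k i, (k < n)%N -> (i < 2 ^ k)%N -> A k i (haar k i x)])) /\
  (forall (s : seq nat) (E : nat -> set R), uniq s ->
     (forall n, n \in s -> (0 < n)%N /\ hsig h n (E n)) ->
     lam (unitI `&` \bigcap_(n in [set n | n \in s]) E n)
     = ((\prod_(n <- s) fine (lam (unitI `&` E n)))%:E)%E).

Definition lincomb (h : nat -> nat -> nat -> R -> R)
    (s : seq (nat * nat * nat)) (c : nat * nat * nat -> R) : R -> R :=
  fun x => \sum_(t <- s) c t * h t.1.1 t.1.2 t.2 x.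

Definition inRp0 (p : R) (h : nat -> nat -> nat -> R -> R) (f : R -> R) : Prop :=
  inLp p f /\
  forall eps : R, 0 < eps -> exists s c, all vidx s /\
    Lpnorm p (fun x => f x - lincomb h s c x) < eps.

(* T is a bounded linear operator on R^{p,0}_omega
   (linearity up to equality a.e. on [0,1], as elements of L_p) *)
Definition bdd_lin_op (p : R) (h : nat -> nat -> nat -> R -> R)
    (T : (R -> R) -> (R -> R)) : Prop :=
  (forall f, inRp0 p h f -> inRp0 p h (T f)) /\
  (forall (a : R) f g, inRp0 p h f -> inRp0 p h g ->
     lam (unitI `&` [set x | T (fun y => a * f y + g y) x <> a * T f x + T g x]) = 0%E) /\
  (exists C : R, forall f, inRp0 p h f -> Lpnorm p (T f) <= C * Lpnorm p f).

Definition opnorm (p : R) (h : nat -> nat -> nat -> R -> R)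
    (T : (R -> R) -> (R -> R)) : R :=
  sup [set Lpnorm p (T f) | f in [set f | inRp0 p h f /\ Lpnorm p f <= 1]].

Definition umean (U : finType) (S : {set U}) (X : U -> R) : R :=
  (\sum_(u in S) X u) / #|S|%:R.
Definition uvar (U : finType) (S : {set U}) (X : U -> R) : R :=
  umean S (fun u => (X u - umean S X) ^+ 2).

Definition sgn (b : bool) : R := if b then -1 else 1.

End Defs.

(* Main.v *)
Require Import Defs.
From HB Require Import structures.
From mathcomp Require Import all_boot all_order all_algebra.
From mathcomp Require Import ring lra.
From mathcomp Require Import all_classical all_reals all_analysis.
From mathcomp Require Import measurable_realfun.
Set Implicit Arguments. Unset Strict Implicit. Unset Printing Implicit Defensive.
Import Order.TTheory GRing.Theory Num.Theory.
Local Open Scope classical_set_scope.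
Local Open Scope ring_scope.

(** Write [a K L = <h_K, T h_L>] for [K, L] in [B]. Since the squares of the signs
    are 1, [Z] is the off-diagonal Rademacher chaos [sum_(K != L) th_K th_L a K L],
    so [E Z = 0], and orthogonality of the products of two signs gives
    [Var Z = sum_(K != L) a K L (a K L + a L K) <= 2 sum_(K, L) (a K L)^2].
    By Hoelder [|a K L| <= |T| 2^-N]. With signs [e_L] such that [e_L a K L = |a K L|],
    [sum_L |a K L| = <h_K, T (sum_L e_L h_L)> <= 2^(-N/q) |T| |U B|^(1/p)], because
    the [h_L] of one level are almost everywhere disjointly supported with values
    in [{-1, 0, 1}]. Bounding one factor of each square by its maximum and summing
    the other over [L], then over the [|U B| 2^N] indices [K], yields the claim. *)

(** * Mean and variance of a Rademacher chaos of order two *)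

Section Rademacher.
Variables (R : realType) (I : finType) (B : {set I}).

(** A sign vector on [B] is stored as a boolean function on all of [I] that is [false] off [B], so
    each element of {-1,1}^B is counted exactly once. *)
Let signs := finset (fun th : {ffun I -> bool} => [forall K, (K \notin B) ==> ~~ th K]).
Let sign_pair (th : {ffun I -> bool}) (u : I * I) : R := sgn R (th u.1) * sgn R (th u.2).
Let D (u : I * I) : bool := [&& u.1 \in B, u.2 \in B & u.1 != u.2].
Let flip (J : I) (th : {ffun I -> bool}) := [ffun K => (K == J) (+) th K].
Let swap (u : I * I) := (u.2, u.1).

Lemma sgn_addb (b c : bool) : sgn R (b (+) c) = sgn R b * sgn R c.
Proof. by case: b; case: c; rewrite /sgn /= ?mulrNN ?mulr1 ?mul1r. Qed.

Lemma sgn_sqr (b : bool) : sgn R b * sgn R b = 1.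
Proof. by rewrite -sgn_addb addbb. Qed.

Lemma flipK J : involutive (flip J).
Proof. by move=> th; apply/ffunP => K; rewrite !ffunE addbA addbb. Qed.

Lemma flip_signs J th : J \in B -> (flip J th \in signs) = (th \in signs).
Proof.
move=> JB; rewrite !inE; apply: eq_forallb => K; rewrite ffunE.
by case: eqVneq => [->|//]; rewrite JB.
Qed.

Lemma signs_gt0 : (0 < #|signs|)%N.
Proof.
apply/card_gt0P; exists [ffun => false]; rewrite inE; apply/forallP => K.
by rewrite ffunE implybT.
Qed.

(** For [J] in [B], [flip J] is a bijection of [signs]; reindexing along it shows that the sum
    equals its own negative. *)
Lemma sum_flip_odd J (X : {ffun I -> bool} -> R) : J \in B ->
  (forall th, X (flip J th) = - X th) -> \sum_(th in signs) X th = 0.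
Proof.
move=> JB XJ.
have : \sum_(th in signs) X th = - \sum_(th in signs) X th.
  rewrite [LHS](reindex_inj (inv_inj (flipK J))) /=.
  under eq_bigl => th do rewrite flip_signs//.
  by under eq_bigr => th _ do rewrite XJ; rewrite sumrN.
by move=> e; lra.
Qed.

Lemma sign_pair_flip J th u :
  sign_pair (flip J th) u = sgn R ((u.1 == J) (+) (u.2 == J)) * sign_pair th u.
Proof. by rewrite /sign_pair /flip !ffunE !sgn_addb; ring. Qed.

Lemma sum_sign_pair u : D u -> \sum_(th in signs) sign_pair th u = 0.
Proof.
move=> /and3P[u1B _ u12]; apply: (sum_flip_odd u1B) => th.
by rewrite sign_pair_flip eqxx eq_sym (negbTE u12) /= /sgn mulN1r.
Qed.

(** The four signs multiply to 1 when both pairs have the same underlying set; otherwise some index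
    occurs an odd number of times and flipping it kills the sum. As [u] is off the diagonal, [u] and
    [swap u] differ, so at most one of the two indicators is 1. *)
Lemma sum_sign_pairM u v : D u -> D v ->
  \sum_(th in signs) sign_pair th u * sign_pair th v = #|signs|%:R * ((v == u) + (v == swap u))%:R.
Proof.
case: u v => [k l] [k' l'] /and3P/=[kB lB kl] /and3P/=[kB' lB' kl'].
rewrite /swap !xpair_eqE /=.
have wsqr th : sign_pair th (k, l) * sign_pair th (k, l) = 1.
  by rewrite /sign_pair /= mulrACA !sgn_sqr mulr1.
have wC th : sign_pair th (l, k) = sign_pair th (k, l) by rewrite /sign_pair mulrC.
(* It remains, in each mismatched case, to exhibit an index [J] of odd multiplicity: [l] if only
   [k' = k], [k] if only [k' = l], and [k'] if it is neither. *)
have odd J : J \in B -> ((k == J) (+) (l == J)) (+) ((k' == J) (+) (l' == J)) ->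
    \sum_(th in signs) sign_pair th (k, l) * sign_pair th (k', l') = 0.
  move=> JB odJ; apply: (sum_flip_odd JB) => th.
  by rewrite !sign_pair_flip mulrACA -sgn_addb odJ /sgn mulN1r.
have [ek|nk] := eqVneq k' k.
  subst k'; rewrite (negbTE kl) /= addn0.
  have [el|nl] := eqVneq l' l.
    by subst l'; under eq_bigr => th _ do rewrite wsqr; rewrite sumr_const mulr1.
  rewrite mulr0; apply: (odd l) => //.
  by rewrite eqxx (negbTE kl) (negbTE nl).
rewrite andFb add0n.
have [ek|nkl] := eqVneq k' l.
  subst k'; have [el|nl] := eqVneq l' k.
    by subst l'; under eq_bigr => th _ do rewrite wC wsqr; rewrite sumr_const mulr1.
  rewrite mulr0; apply: (odd k) => //.
  by rewrite eqxx (negbTE nl) (eq_sym l) (negbTE kl).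
rewrite mulr0; apply: (odd k') => //.
by rewrite eqxx (eq_sym l') (negbTE kl') (eq_sym k) (negbTE nk) (eq_sym l) (negbTE nkl).
Qed.

Lemma umean_chaos (a : I * I -> R) :
  umean signs (fun th => \sum_(u | D u) sign_pair th u * a u) = 0.
Proof.
rewrite /umean exchange_big /= big1 ?mul0r// => u Du.
by rewrite -mulr_suml sum_sign_pair ?mul0r.
Qed.

(** After expanding the square, only [v = u] and [v = swap u] survive for each [u]. The cross terms
    are absorbed by the inequality between geometric and arithmetic means, as [swap] permutes the
    off-diagonal pairs. *)
Lemma umean_chaos_sqr (a : I * I -> R) :
  umean signs (fun th => (\sum_(u | D u) sign_pair th u * a u) ^+ 2)
  <= 2 * \sum_(u | D u) a u ^+ 2.
Proof.
have Dswap u : D (swap u) = D u by rewrite /D /= eq_sym andbCA.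
have swapK : involutive swap by case.
have -> : umean signs (fun th => (\sum_(u | D u) sign_pair th u * a u) ^+ 2)
    = \sum_(u | D u) (a u ^+ 2 + a u * a (swap u)).
  apply: (@mulIf _ #|signs|%:R); first by rewrite pnatr_eq0 -lt0n signs_gt0.
  rewrite /umean divfK ?pnatr_eq0 -?lt0n ?signs_gt0//.
  under eq_bigr => th _ do rewrite expr2 big_distrlr /=.
  rewrite exchange_big /= mulr_suml; apply: eq_bigr => u Du.
  rewrite exchange_big /=.
  transitivity (\sum_(v | D v)
      a u * a v * #|signs|%:R * ((v == u)%:R + (v == swap u)%:R)).
    apply: eq_bigr => v Dv; rewrite -natrD.
    under eq_bigr => th _ do rewrite mulrACA mulrC.
    by rewrite -mulr_sumr sum_sign_pairM// mulrA.
  under eq_bigr => v _ do rewrite mulrDr.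
  rewrite big_split /= (bigD1 u)//= eqxx [X in _ + X + _]big1 => [|v /andP[_ /negbTE->]];
    last by rewrite mulr0.
  rewrite (bigD1 (swap u)) ?Dswap//= eqxx [X in _ + (_ + X)]big1 => [|v /andP[_ /negbTE->]];
    last by rewrite mulr0.
  rewrite /= !mulr1 !addr0. by ring.
have swap_sum : \sum_(u | D u) a (swap u) ^+ 2 = \sum_(u | D u) a u ^+ 2.
  rewrite [RHS](reindex_inj (inv_inj swapK)) /=.
  by apply: eq_bigl => u; rewrite Dswap.
(* One copy of the sum is symmetrised under [swap], so that the comparison can be made term by
   term. *)
have -> : 2 * \sum_(u | D u) a u ^+ 2
    = \sum_(u | D u) (a u ^+ 2 + 2^-1 * (a u ^+ 2 + a (swap u) ^+ 2)).
  rewrite big_split /= -mulr_sumr big_split /= swap_sum; lra.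
apply: ler_sum => u _; rewrite lerD2l.
have := sqr_ge0 (a u - a (swap u)); nra.
Qed.

End Rademacher.

(** * Dyadic intervals and Haar functions *)

Section Dyadic.
Variable R : realType.

Lemma dint_inj k i j (x : R) : @dint R k i x -> @dint R k j x -> i = j.
Proof.
have k0 : (0 : R) < ((2 ^ k)%:R)^-1 by rewrite invr_gt0 ltr0n expn_gt0.
rewrite /dint /= !in_itv /= => /andP[i1 i2] /andP[j1 j2].
have := le_lt_trans i1 j2; rewrite ltr_pM2r// ltr_nat ltnS => ij.
have := le_lt_trans j1 i2; rewrite ltr_pM2r// ltr_nat ltnS => ji.
by apply/eqP; rewrite eqn_leq ij ji.
Qed.

Lemma measurable_dint k i : measurable (@dint R k i).
Proof. exact: measurable_itv. Qed.

Lemma lam_dint k i : @lam R (@dint R k i) = (((2 ^ k)%:R)^-1)%:E.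
Proof.
have k0 : (0 : R) < ((2 ^ k)%:R)^-1 by rewrite invr_gt0 ltr0n expn_gt0.
rewrite /lam /dint lebesgue_measure_itv /= lte_fin ltr_pM2r// ltr_nat ltnSn.
by rewrite EFinN -EFinB -mulrBl -natrB ?subSnn// mul1r.
Qed.

Lemma dint_unitI k i : (i < 2 ^ k)%N -> @dint R k i `<=` @unitI R.
Proof.
move=> ik x; have k0 : (0 : R) < (2 ^ k)%:R by rewrite ltr0n expn_gt0.
rewrite /dint /unitI /= !in_itv /= => /andP[i1 i2]; apply/andP; split.
  by apply: le_trans i1; rewrite divr_ge0.
apply: ltW; apply: lt_le_trans i2 _.
by rewrite ler_pdivrMr// mul1r ler_nat.
Qed.

Lemma dintS k i : @dint R k i = @dint R k.+1 i.*2 `|` @dint R k.+1 i.*2.+1.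
Proof.
have half (j : nat) : (j.*2)%:R / (2 ^ k.+1)%:R = j%:R / (2 ^ k)%:R :> R.
  have k0 : (2 ^ k)%:R != 0 :> R by rewrite pnatr_eq0 expn_eq0.
  by rewrite expnS natrM -muln2 natrM; field.
apply/seteqP; rewrite /dint; split => x /=; rewrite !in_itv /= -doubleS !half.
  move=> /andP[-> ->]; rewrite andbT.
  by case: (ltP x) => _; [left|right].
have le1 : i%:R / (2 ^ k)%:R <= (i.*2).+1%:R / (2 ^ k.+1)%:R :> R.
  by rewrite -half ler_pM2r ?invr_gt0 ?ltr0n ?expn_gt0// ler_nat.
have le2 : (i.*2).+1%:R / (2 ^ k.+1)%:R <= i.+1%:R / (2 ^ k)%:R :> R.
  by rewrite -half ler_pM2r ?invr_gt0 ?ltr0n ?expn_gt0// ler_nat doubleS.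
by case=> /andP[x1 x2]; apply/andP; split => //;
  [exact: lt_le_trans le2|exact: le_trans x1].
Qed.

(** This gives both facts about Haar functions that are later transferred to the copies: the values
    lie in {-1, 0, 1}, and the support is the dyadic interval. *)
Lemma normr_haar k i (x : R) : `|haar k i x| = \1_(@dint R k i) x.
Proof.
rewrite /haar (dintS k i) !indicE.
have [/set_mem l|l] := boolP (x \in @dint R k.+1 i.*2).
  have -> : x \in @dint R k.+1 i.*2 `|` @dint R k.+1 i.*2.+1 by apply/mem_set; left.
  have -> : (x \in @dint R k.+1 i.*2.+1) = false.
    by apply/negP => /set_mem r; have /eqP := dint_inj l r;
      rewrite -[X in X == _]addn0 -addn1 eqn_add2l.
  by rewrite subr0 normr1.
have -> : (x \in @dint R k.+1 i.*2 `|` @dint R k.+1 i.*2.+1) = (x \in @dint R k.+1 i.*2.+1).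
  by rewrite in_setU (negbTE l).
by rewrite sub0r normrN normr_nat.
Qed.

(** By disjointness the measure of the union becomes a count, the form in which the summation over
    [K] produces it. *)
Lemma lam_bigcup_dint k (B : {set 'I_(2 ^ k)}) :
  @lam R (\bigcup_(K in [set K | K \in B]) @dint R k K) = (#|B|%:R / (2 ^ k)%:R)%:E.
Proof.
rewrite (@bigcup_pred _ _ (mem B)) /lam measure_bigsetU_ord_cond.
- rewrite (eq_bigr (fun _ => (((2 ^ k)%:R)^-1)%:E)) => [|K _]; last exact: lam_dint.
  have cB : #|mem B| = #|B| by exact: eq_card.
  by rewrite sumEFin sumr_const cB mulr_natl.
- by move=> K _; exact: measurable_dint.
- move=> K L _ _ [x [Kx Lx]]; apply/val_inj; exact: dint_inj Kx Lx.
Qed.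

End Dyadic.

(** * Hoelder's inequality and the duality pairing on the unit interval *)

Section Hoelder.
Variable R : realType.
Implicit Types (f g : R -> R) (p q r a : R).

Lemma measurable_unitI : measurable (@unitI R).
Proof. exact: measurable_itv. Qed.

Lemma Lp_int_ge0 r f : (0 <= Lp_int r f)%E.
Proof. by apply: integral_ge0 => x _; rewrite lee_fin powR_ge0. Qed.

(** Finiteness is essential: [fine] sends an infinite integral to 0. *)
Lemma EFin_Lpnorm r f : (Lp_int r f < +oo)%E ->
  (Lpnorm r f)%:E = (Lp_int r f `^ r^-1)%E.
Proof.
move=> fr; rewrite /Lpnorm -[in RHS](@fineK _ (Lp_int r f)) ?poweR_EFin//.
by rewrite ge0_fin_numE// Lp_int_ge0.
Qed.

(** Cutting off by the indicator of the unit interval makes Hoelder's inequality on the whole line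
    applicable; positivity of [r] ensures that the cut-off part contributes 0. *)
Lemma Lnorm_unitI r f : 0 < r ->
  Lnorm (@lebesgue_measure R) r%:E (EFin \o (f \* \1_(@unitI R))) = (Lp_int r f `^ r^-1)%E.
Proof.
move=> r0; rewrite unlock; congr (_ `^ _)%E.
rewrite /Lp_int /lam [RHS]integral_mkcond; apply: eq_integral => x _.
rewrite patchE /= indicE; case: ifPn => _; first by rewrite mulr1.
by rewrite mulr0 normr0 powR0// gt_eqF.
Qed.

Lemma hoelder_unitI p q g f : 0 < p -> 0 < q -> p^-1 + q^-1 = 1 ->
  measurable_fun setT g -> measurable_fun setT f ->
  (\int[@lam R]_(x in @unitI R) `|(g x * f x)%:E|
    <= Lp_int q g `^ q^-1 * Lp_int p f `^ p^-1)%E.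
Proof.
move=> p0 q0 pq mg mf.
have m1 : measurable_fun setT (\1_(@unitI R) : R -> R).
  exact: measurable_indic measurable_unitI.
have mg1 : measurable_fun setT (g \* \1_(@unitI R)) by exact: measurable_funM.
have mf1 : measurable_fun setT (f \* \1_(@unitI R)) by exact: measurable_funM.
have qp : q^-1 + p^-1 = 1 by rewrite addrC.
have := hoelder (@lebesgue_measure R) mg1 mf1 q0 p0 qp.
rewrite !Lnorm_unitI// Lnorm1; apply: le_trans.
rewrite [X in (X <= _)%E]integral_mkcond /lam le_eqVlt; apply/orP; left; apply/eqP.
apply: eq_integral => x _; rewrite patchE /= indicE.
by case: ifPn => _; rewrite ?mulr1 ?mulr0 ?normr0.
Qed.

Section pairing.
Variables (p q : R).
Hypotheses (p0 : 0 < p) (q0 : 0 < q) (pq : p^-1 + q^-1 = 1).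

Lemma integrable_ip g f : inLp q g -> inLp p f ->
  (@lebesgue_measure R).-integrable (@unitI R) (fun x => (g x * f x)%:E).
Proof.
move=> [mg gq] [mf fp]; apply/integrableP; split.
  by apply/measurable_EFinP/measurable_funTS; exact: measurable_funM.
apply: le_lt_trans (hoelder_unitI p0 q0 pq mg mf) _.
by rewrite ltey_eq fin_numM// fin_num_poweR// ge0_fin_numE// Lp_int_ge0.
Qed.

Lemma fin_num_ip g f : inLp q g -> inLp p f ->
  (\int[@lam R]_(x in @unitI R) (g x * f x)%:E)%E \is a fin_num.
Proof.
by move=> gq fp; apply: integrable_fin_num; [exact: measurable_unitI|exact: integrable_ip].
Qed.

Lemma ip_hoelder g f : inLp q g -> inLp p f ->
  `|ip g f| <= Lpnorm q g * Lpnorm p f.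
Proof.
move=> Lg Lf; case: (Lg) (Lf) => [mg gq] [mf fp].
have := hoelder_unitI p0 q0 pq mg mf.
rewrite -(EFin_Lpnorm gq) -(EFin_Lpnorm fp) -EFinM => H.
rewrite -lee_fin -[X in (X <= _)%E]/(`|(ip g f)%:E|)%E /ip fineK ?fin_num_ip//.
apply: le_trans H; apply: le_abse_integral; first exact: measurable_unitI.
by apply/measurable_EFinP/measurable_funTS; exact: measurable_funM.
Qed.

Lemma ip_linear g a f1 f2 : inLp q g -> inLp p f1 -> inLp p f2 ->
  ip g (fun x => a * f1 x + f2 x) = a * ip g f1 + ip g f2.
Proof.
move=> Lg L1 L2; rewrite /ip.
have -> : (\int[@lam R]_(x in @unitI R) (g x * (a * f1 x + f2 x))%:E =
    \int[@lam R]_(x in @unitI R) (a%:E * (g x * f1 x)%:E + (g x * f2 x)%:E))%E.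
  by apply: eq_integral => x _; rewrite -EFinM -EFinD; congr EFin; ring.
rewrite integralD//; last 3 first.
  exact: measurable_unitI.
  by apply: integrableZl; [exact: measurable_unitI|exact: integrable_ip].
  exact: integrable_ip.
rewrite integralZl//; [|exact: measurable_unitI|exact: integrable_ip].
by rewrite fineD ?fineM ?fin_numM ?fin_num_ip.
Qed.

Lemma ip_suml (I : finType) (c : I -> R) (g : I -> R -> R) f :
  (forall i, inLp q (g i)) -> inLp p f ->
  ip (fun x => \sum_i c i * g i x) f = \sum_i c i * ip (g i) f.
Proof.
move=> Lg Lf; rewrite /ip.
have -> : (\int[@lam R]_(x in @unitI R) ((\sum_i c i * g i x) * f x)%:E =
    \int[@lam R]_(x in @unitI R) (\sum_i (c i)%:E * (g i x * f x)%:E))%E.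
  apply: eq_integral => x _; rewrite mulr_suml -sumEFin.
  by apply: eq_bigr => i _; rewrite -EFinM mulrA.
rewrite integral_sum; [|exact: measurable_unitI|]; last first.
  by move=> i; apply: integrableZl; [exact: measurable_unitI|exact: integrable_ip].
rewrite -sum_fine /=.
  apply: eq_bigr => i _.
  rewrite integralZl//; [|exact: measurable_unitI|exact: integrable_ip].
  by rewrite fineM ?fin_num_ip.
move=> i _; rewrite integralZl//; [|exact: measurable_unitI|exact: integrable_ip].
by rewrite fin_numM ?fin_num_ip.
Qed.

End pairing.

(** Since [T] is linear only up to null sets, this is what makes its pairings exactly linear. *)
Lemma ip_ae_eq g f1 f2 : measurable_fun setT g ->
  measurable_fun setT f1 -> measurable_fun setT f2 ->
  lam (@unitI R `&` [set x | f1 x <> f2 x]) = 0%E -> ip g f1 = ip g f2.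
Proof.
move=> mg m1 m2 f12; rewrite /ip; congr fine.
have mI := measurable_unitI.
apply: ae_eq_integral => //.
- by apply/measurable_EFinP/measurable_funTS; exact: measurable_funM.
- by apply/measurable_EFinP/measurable_funTS; exact: measurable_funM.
exists (@unitI R `&` [set x | f1 x <> f2 x]); split => //.
- have -> : [set x | f1 x <> f2 x] = [set x | (f1 x)%:E != (f2 x)%:E].
    by apply/seteqP; split => x /=; rewrite eqe => /eqP.
  by apply: measurable_neqe => //; apply/measurable_EFinP/measurable_funTS.
- move=> x /= /not_implyP[Ix e]; split => // e'; apply: e.
  by rewrite e'.
Qed.

End Hoelder.

(** * Copies of one level of the Haar system and their linear combinations *)

Section Copies.
Variables (R : realType) (h : nat -> nat -> nat -> R -> R).
Hypothesis hh : haar_copies h.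
Local Notation mu := (@lebesgue_measure R).

Lemma haar_copies_joint n k i j (A A' : set R) :
  (k < n)%N -> (i < 2 ^ k)%N -> (j < 2 ^ k)%N -> measurable A -> measurable A' ->
  lam (@unitI R `&` [set x | A (h n k i x) /\ A' (h n k j x)]) =
  lam (@unitI R `&` [set x | A (haar k i x) /\ A' (haar k j x)]).
Proof.
move=> kn ik jk mA mA'.
(* All coordinates but two are left unconstrained. Intersecting the two conditions, instead of
   nesting the conditionals, keeps both of them when [i = j]. *)
pose C k' i' : set R := (if (k' == k) && (i' == i) then A else setT) `&`
  (if (k' == k) && (i' == j) then A' else setT).
have mC k' i' : measurable (C k' i') by apply: measurableI; case: ifP.
have CE (g : nat -> nat -> R -> R) :
    [set x | forall k' i', (k' < n)%N -> (i' < 2 ^ k')%N -> C k' i' (g k' i' x)] =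
    [set x | A (g k i x) /\ A' (g k j x)].
  apply/seteqP; split => x /=.
    move=> H; split; [move: (H k i kn ik) => -[+ _]|move: (H k j kn jk) => -[_]];
      by rewrite !eqxx.
  move=> [Ax A'x] k' i' _ _; split; case: ifP => //; move=> /andP[/eqP-> /eqP->] //.
case: hh => _ [+ _] => /(_ n (leq_ltn_trans (leq0n k) kn) C mC).
by rewrite !CE.
Qed.

Section level.
Variables (M N : nat).
Hypothesis NM : (N < M)%N.
Implicit Types (K L : 'I_(2 ^ N)) (c : 'I_(2 ^ N) -> R) (r : R).

Lemma measurable_copy K : measurable_fun setT (h M N K).
Proof.
by case: hh => + _; apply; rewrite /vidx /= NM (leq_ltn_trans (leq0n N) NM) ltn_ord.
Qed.

Lemma measurable_copy_neq0 K : measurable [set x | h M N K x <> 0].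
Proof.
rewrite -[X in measurable X]setTI.
by apply: (@measurable_copy K _ (~` [set 0])) => //; apply: measurableC; exact: measurable_set1.
Qed.

Lemma lam_copy_neq0 K : lam (@unitI R `&` [set x | h M N K x <> 0]) = (((2 ^ N)%:R)^-1)%:E.
Proof.
have mA : measurable (~` [set 0] : set R) by apply: measurableC; exact: measurable_set1.
have -> : [set x | h M N K x <> 0] = [set x | (~` [set 0]) (h M N K x) /\ setT (h M N K x)].
  by apply/seteqP; split => x //= [].
rewrite haar_copies_joint//.
rewrite -(lam_dint R N K); congr lam; apply/seteqP; split => x /=.
  move=> [_ [x0 _]]; apply: contrapT => nx; apply: x0; apply/eqP.
  by rewrite -normr_eq0 normr_haar indicE memNset.
move=> Kx; split; first exact: dint_unitI Kx.
split => // x0; have := normr_haar N K x.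
by rewrite x0 normr0 indicE mem_set// => /esym/eqP; rewrite oner_eq0.
Qed.

(** The Haar function never takes a value outside {0, 1, -1}; equality of distributions turns this
    empty event into a null event for the copy. *)
Lemma copy_ae_norm K :
  {ae mu, forall x, @unitI R x -> `|h M N K x| = (h M N K x != 0)%:R}.
Proof.
pose A : set R := ~` ([set 0] `|` [set 1] `|` [set -1]).
have mA : measurable A.
  by apply: measurableC; apply: measurableU; [apply: measurableU|]; exact: measurable_set1.
have AE : [set x | A (h M N K x) /\ setT (h M N K x)] = h M N K @^-1` A.
  by apply/seteqP; split => x //= [].
exists (@unitI R `&` [set x | A (h M N K x) /\ setT (h M N K x)]); split.
- rewrite AE; apply: measurableI; first exact: measurable_unitI.
  by rewrite -[X in measurable X]setTI; exact: measurable_copy.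
- apply: etrans (haar_copies_joint _ _ _ mA measurableT) _ => //.
  rewrite (_ : _ `&` _ = set0) ?measure0//; apply/seteqP; split => x //=.
  move=> [_ [nA _]]; have := normr_haar N K x; rewrite indicE => e; apply: nA => /=.
  case: (x \in _) e => /eqP.
    by rewrite eqr_norml => /andP[/orP[]/eqP-> _]; [left; right|right].
  by rewrite normr_eq0 => /eqP->; left; left.
- move=> x /= /not_implyP[Ix e]; split => //; split => // -[[h0|h1]|h1]; apply: e.
  + by rewrite h0 normr0 eqxx.
  + by rewrite h1 normr1 oner_eq0.
  + by rewrite h1 normrN normr1 oppr_eq0 oner_eq0.
Qed.

(** Two Haar functions of one level are never nonzero together, and the joint distribution carries
    this over up to a null set. *)
Lemma copy_ae_disjoint K L : K != L ->
  {ae mu, forall x, @unitI R x -> h M N K x = 0 \/ h M N L x = 0}.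
Proof.
move=> KL; have mA : measurable (~` [set 0] : set R).
  by apply: measurableC; exact: measurable_set1.
exists (@unitI R `&` [set x | (~` [set 0]) (h M N K x) /\ (~` [set 0]) (h M N L x)]); split.
- apply: measurableI; first exact: measurable_unitI.
  exact: measurableI (measurable_copy_neq0 K) (measurable_copy_neq0 L).
- apply: etrans (haar_copies_joint _ _ _ mA mA) _ => //.
  rewrite (_ : _ `&` _ = set0) ?measure0//; apply/seteqP; split => x //=.
  move=> [_ [K0 L0]].
  have dK (J : 'I_(2 ^ N)) : haar N J x <> 0 -> dint N J x.
    move=> J0; apply: contrapT => nx; apply: J0; apply/eqP.
    by rewrite -normr_eq0 normr_haar indicE memNset.
  by move/eqP: KL; apply; apply/val_inj; exact: dint_inj (dK _ K0) (dK _ L0).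
- move=> x /= /not_implyP[Ix e]; split => //.
  by split => h0; apply: e; [left|right].
Qed.

(** The vectors b(theta), the single copies and the sign-adjusted test vectors all have this
    form. *)
Definition hsum c (x : R) : R := \sum_(K < 2 ^ N) c K * h M N K x.

Lemma measurable_hsum c : measurable_fun setT (hsum c).
Proof.
by apply: measurable_sum => K; apply: measurable_funM => //; exact: measurable_copy.
Qed.

(** At almost every point at most one summand is nonzero, so the power passes through the sum. *)
Lemma hsum_ae r c : 0 < r -> {ae mu, forall x, @unitI R x ->
  `|hsum c x| `^ r = \sum_(K < 2 ^ N) `|c K| `^ r * \1_[set x | h M N K x <> 0] x}.
Proof.
move=> r0; pose aeF := ae_filter_ringOfSetsType mu.
have aeN : {ae mu, forall x K, @unitI R x -> `|h M N K x| = (h M N K x != 0)%:R}.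
  by apply: (@filter_forall _ _ _ _ aeF) => K; exact: copy_ae_norm.
have aeD : {ae mu, forall x (u : 'I_(2 ^ N) * 'I_(2 ^ N)), u.1 != u.2 ->
    @unitI R x -> h M N u.1 x = 0 \/ h M N u.2 x = 0}.
  apply: (@filter_forall _ _ _ _ aeF) => -[K L] /=; have [KL|KL] := eqVneq K L.
    by apply: aeW => x /=; rewrite ?KL ?eqxx.
  by move: (copy_ae_disjoint KL); apply: (@filterS _ _ aeF) => x H _; exact: H.

apply: (@filterS2 _ _ aeF) aeN aeD => x HN HD Ix.
have ind K : \1_[set x | h M N K x <> 0] x = (h M N K x != 0)%:R :> R.
  by rewrite indicE; congr (_%:R); congr nat_of_bool;
    apply/idP/idP => [/set_mem /eqP|/eqP ?]//; apply/mem_set.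
(* Either a single copy is alive at [x] and both sums collapse to its term, or all copies vanish
   there and both sides are 0 because [r > 0]. *)
have [[K hK]|none] := pselect (exists K, h M N K x != 0).
  have off L : L != K -> h M N L x = 0.
    move=> LK; case: (HD (L, K) LK Ix) => //= h0.
    by rewrite h0 eqxx in hK.
  rewrite /hsum (bigD1 K)//= [in RHS](bigD1 K)//= !big1 => [|L LK|L LK];
    try by rewrite ?ind off// ?eqxx mulr0.
  by rewrite !addr0 ind normrM HN// hK !mulr1.
have off K : h M N K x = 0.
  by apply/eqP; apply: contrapT => /negP ?; apply: none; exists K.
rewrite /hsum !big1 => [|K _|K _]; try by rewrite ?ind off ?eqxx mulr0.
by rewrite normr0 powR0// gt_eqF.
Qed.

(** Each support has measure 2^-N, so [hsum] is an isometry from a weighted finite-dimensional l_r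
    space; all later norms are read off from this. *)
Lemma Lp_int_hsum r c : 0 < r ->
  Lp_int r (hsum c) = ((\sum_(K < 2 ^ N) `|c K| `^ r) / (2 ^ N)%:R)%:E.
Proof.
move=> r0; have mI := @measurable_unitI R.
have mind K : measurable_fun setT (\1_[set x | h M N K x <> 0] : R -> R).
  by apply: measurable_indic; exact: measurable_copy_neq0.
transitivity (\int[mu]_(x in @unitI R)
  (\sum_(K < 2 ^ N) (`|c K| `^ r)%:E * (\1_[set x | h M N K x <> 0] x)%:E))%E.
  apply: ge0_ae_eq_integral => //.
  - apply/measurable_EFinP/measurable_funTS.
    apply: (measurableT_comp (measurable_powR r)); apply: measurableT_comp => //.
    exact: measurable_hsum.
  - apply/measurable_funTS; apply: emeasurable_sum => K.
    by apply: measurable_funeM; apply/measurable_EFinP; exact: mind.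
  - by move=> x _; rewrite sume_ge0// => K _; rewrite mule_ge0// lee_fin powR_ge0.
  - apply: (@filterS _ _ (ae_filter_ringOfSetsType mu)) (hsum_ae c r0) => x + Ix => ->//.
    by rewrite -sumEFin.
rewrite ge0_integral_sum//; last first.
  move=> K; apply/measurable_funTS.
  by apply: measurable_funeM; apply/measurable_EFinP; exact: mind.
rewrite mulr_suml -sumEFin; apply: eq_bigr => K _.
rewrite ge0_integralZl//; last by apply/measurable_funTS/measurable_EFinP; exact: mind.
rewrite EFinM; congr (_ * _)%E.
rewrite integral_indic//; last exact: measurable_copy_neq0.
by rewrite setIC; exact: lam_copy_neq0.
Qed.

Lemma inLp_hsum r c : 0 < r -> inLp r (hsum c).
Proof. by move=> r0; split; [exact: measurable_hsum|rewrite Lp_int_hsum// ltry]. Qed.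

Lemma Lpnorm_hsum r c : 0 < r ->
  Lpnorm r (hsum c) = ((\sum_(K < 2 ^ N) `|c K| `^ r) / (2 ^ N)%:R) `^ r^-1.
Proof. by move=> r0; rewrite /Lpnorm Lp_int_hsum. Qed.

Lemma inRp0_hsum r c : 0 < r -> inRp0 r h (hsum c).
Proof.
move=> r0; split; first exact: inLp_hsum.
move=> eps eps0.
exists [seq (M, N, nat_of_ord K) | K : 'I_(2 ^ N) <- enum 'I_(2 ^ N)].
(* Coefficients in [lincomb] are indexed by triples of naturals; [insub] recovers the ordinal, and
   the default 0 is never reached on the chosen list. The approximation error is exactly 0. *)
exists (fun t => if insub t.2 is Some K then c K else 0); split.
  apply/allP => t /mapP[K _ ->].
  by rewrite /vidx /= NM (leq_ltn_trans (leq0n N) NM) ltn_ord.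
rewrite [X in Lpnorm _ X](_ : _ = cst 0).
  rewrite /Lpnorm /Lp_int (eq_integral (cst 0%E)).
    by rewrite integral0 powR0// invr_eq0 gt_eqF.
  by move=> x _; rewrite /= normr0 powR0// gt_eqF.
apply/funext => x; rewrite /lincomb /hsum big_map big_enum /=.
rewrite -sumrB big1// => K _.
by rewrite valK subrr.
Qed.

End level.
End Copies.

(** * Linear functionals on coefficient vectors *)

Lemma linear_functional0 (R : realType) (I : finType) (phi : (I -> R) -> R) :
  (forall a c d, phi (fun i => a * c i + d i) = a * phi c + phi d) ->
  phi (fun=> 0) = 0.
Proof.
move=> /(_ 1 (fun=> 0) (fun=> 0)).
rewrite [X in phi X = _](_ : _ = fun=> 0); first by move=> e; lra.
by apply/funext => i; rewrite mulr0 addr0.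
Qed.

Lemma linear_functional_sum (R : realType) (I : finType) (phi : (I -> R) -> R) :
  (forall a c d, phi (fun i => a * c i + d i) = a * phi c + phi d) ->
  forall c, phi c = \sum_i c i * phi (fun j => (j == i)%:R).
Proof.
move=> phil c.
have phi0 := linear_functional0 phil.
have expand (r : seq I) : phi (fun j => \sum_(i <- r) c i * (j == i)%:R) =
    \sum_(i <- r) c i * phi (fun j => (j == i)%:R).
  elim: r => [|i r IH].
    by rewrite big_nil -phi0; congr phi; apply/funext => j; rewrite big_nil.
  by rewrite big_cons -IH -phil; congr phi; apply/funext => j; rewrite big_cons.
rewrite -expand; congr phi; apply/funext => j.
rewrite (bigD1 j)//= eqxx mulr1 big1 ?addr0// => i.
by rewrite eq_sym => /negbTE->; rewrite mulr0.
Qed.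

(** * Bounds for the matrix entries of the operator *)

Section Operator.
Variables (R : realType) (p : R) (h : nat -> nat -> nat -> R -> R).
Variables (T : (R -> R) -> (R -> R)) (M N : nat).
Hypotheses (p1 : 1 < p) (hh : haar_copies h) (Tlin : bdd_lin_op p h T) (NM : (N < M)%N).
Let q := p / (p - 1).
Let s : R := ((2 ^ N)%:R)^-1.
Let t := opnorm p h T.
Implicit Types (K L : 'I_(2 ^ N)) (c d : 'I_(2 ^ N) -> R).

Let p0 : 0 < p. Proof. exact: lt_trans p1. Qed.

Let q0 : 0 < q. Proof. by rewrite divr_gt0 ?subr_gt0. Qed.

Let pq : p^-1 + q^-1 = 1.
Proof.
by rewrite /q invf_div -{1}[p^-1]mul1r -mulrDl addrC subrK divff// gt_eqF.
Qed.

Lemma copy_hsum K : h M N K = hsum h M (fun L => (L == K)%:R).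
Proof.
apply/funext => x; rewrite /hsum (bigD1 K)//= eqxx mul1r big1 ?addr0// => L /negbTE->.
by rewrite mul0r.
Qed.

Lemma inLp_copy r K : 0 < r -> inLp r (h M N K).
Proof. by move=> r0; rewrite copy_hsum; exact: inLp_hsum. Qed.

Lemma Lpnorm_copy r K : 0 < r -> Lpnorm r (h M N K) = s `^ r^-1.
Proof.
move=> r0; rewrite copy_hsum Lpnorm_hsum// (bigD1 K)//= eqxx normr1 powR1.
rewrite big1 ?addr0 ?mul1r// => L /negbTE->.
by rewrite normr0 powR0// gt_eqF.
Qed.

Lemma inLp_T c : inLp p (T (hsum h M c)).
Proof. by case: Tlin => /(_ _ (inRp0_hsum hh NM c p0))[]. Qed.

Lemma Lpnorm_T_le_opnorm c : Lpnorm p (hsum h M c) <= 1 -> Lpnorm p (T (hsum h M c)) <= t.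
Proof.
move=> c1; apply: ub_le_sup.
  (* The supremum needs a bounded set; the sign of [C] is not prescribed, so [|C|] serves as the
     upper bound. *)
  case: Tlin => _ [_ [C HC]]; exists `|C| => y [f [Lf f1] <-].
  apply: le_trans (HC f Lf) _.
  apply: le_trans (_ : `|C| * Lpnorm p f <= _).
    by apply: ler_wpM2r; rewrite ?powR_ge0// ler_norm.
  by rewrite ler_piMr.
by exists (hsum h M c) => //; split => //; exact: inRp0_hsum.
Qed.

Lemma opnorm_ge0 : 0 <= t.
Proof.
apply: le_trans (@Lpnorm_T_le_opnorm (fun=> 0) _); first exact: powR_ge0.
rewrite Lpnorm_hsum// big1 ?mul0r ?powR0 ?ler01// ?invr_eq0 ?gt_eqF// => K _.
by rewrite normr0 powR0// gt_eqF.
Qed.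

Let phi K c := ip (h M N K) (T (hsum h M c)).

(** Pairing with a copy erases the null set on which [T] may fail to be linear, leaving an exactly
    linear functional of the coefficients. *)
Lemma phi_linear K a c d : phi K (fun L => a * c L + d L) = a * phi K c + phi K d.
Proof.
rewrite /phi -(ip_linear p0 q0 pq); [|exact: inLp_copy|exact: inLp_T|exact: inLp_T].
have hE : hsum h M (fun L => a * c L + d L) =
    (fun y => a * hsum h M c y + hsum h M d y).
  apply/funext => y; rewrite /hsum mulr_sumr -big_split; apply: eq_bigr => L _ /=.
  by rewrite mulrDl mulrA.
apply: ip_ae_eq.
- exact: measurable_copy.
- by case: (inLp_T (fun L => a * c L + d L)).
- by apply: measurable_funD; [apply: measurable_funM => //|]; case: (inLp_T c); case: (inLp_T d).
- rewrite hE; case: Tlin => _ [+ _]; apply; exact: inRp0_hsum.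
Qed.

(** This is Hoelder's inequality together with homogeneity: [opnorm] controls [T] on the unit ball
    only, so [c] is first normalised. *)
Lemma phi_bound K c : `|phi K c| <= s `^ q^-1 * t * Lpnorm p (hsum h M c).
Proof.
set v := Lpnorm p (hsum h M c).
have v0 : 0 <= v by exact: powR_ge0.
have phi0 := linear_functional0 (phi_linear K).
(* Normalisation fails for norm 0, but then the sum of the powers of the coefficients is 0 and [c]
   vanishes identically. *)
have [vz|vz] := eqVneq v 0.
  have -> : c = fun=> 0.
    apply/funext => L; apply/eqP; rewrite -normr_eq0.
    move/eqP: vz; rewrite /v Lpnorm_hsum// powR_eq0 => /andP[+ _].
    rewrite mulf_eq0 invr_eq0 pnatr_eq0 expn_eq0 /= orbF.
    rewrite psumr_eq0 => [|J _]; last exact: powR_ge0.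
    by move=> /allP/(_ L (mem_index_enum _)); rewrite powR_eq0 => /andP[].
  by rewrite phi0 normr0 mulr_ge0// mulr_ge0 ?powR_ge0 ?opnorm_ge0.
have vp : 0 < v by rewrite lt_neqAle eq_sym vz.
(* The added 0 gives [c1] the shape required by [phi_linear]. *)
pose c1 L := v^-1 * c L + 0.
have phiE : phi K c = v * phi K c1 by rewrite phi_linear phi0 addr0 mulrA divff// mul1r.
have n1 : Lpnorm p (hsum h M c1) <= 1.
  have -> : Lpnorm p (hsum h M c1) = v^-1 * v.
    rewrite /v !Lpnorm_hsum//.
    under eq_bigr => L _ do rewrite /c1 addr0 normrM powRM//.
    rewrite -mulr_sumr -mulrA powRM ?powR_ge0//; last first.
      by rewrite mulr_ge0 ?invr_ge0//; apply: sumr_ge0 => L _; exact: powR_ge0.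
    rewrite -powRrM mulfV ?gt_eqF// powRr1// ger0_norm ?invr_ge0//.
    by rewrite /v Lpnorm_hsum.
  by rewrite mulVf.
rewrite phiE normrM ger0_norm// mulrC; apply: ler_wpM2r => //.
apply: le_trans (ip_hoelder p0 q0 pq (inLp_copy K q0) (inLp_T c1)) _.
by rewrite Lpnorm_copy//; apply: ler_wpM2l; [exact: powR_ge0|exact: Lpnorm_T_le_opnorm].
Qed.

Let a K L := ip (h M N K) (T (h M N L)).

Lemma entryE K L : a K L = phi K (fun J => (J == L)%:R).
Proof. by rewrite /a /phi -copy_hsum. Qed.

Lemma phi_sum K c : phi K c = \sum_L c L * a K L.
Proof.
rewrite (linear_functional_sum (phi_linear K)); apply: eq_bigr => L _.
by rewrite entryE.
Qed.

Lemma s_gt0 : 0 < s. Proof. by rewrite invr_gt0 ltr0n expn_gt0. Qed.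

(** The norms of the two copies multiply to [s] raised to 1/q + 1/p = 1. *)
Lemma entry_bound K L : `|a K L| <= t * s.
Proof.
rewrite entryE; apply: le_trans (phi_bound _ _) _.
have s0 : s != 0 by rewrite gt_eqF ?s_gt0.
have sE : s `^ q^-1 * s `^ p^-1 = s.
  rewrite -powRD; last by rewrite s0 implybT.
  by rewrite addrC pq; apply: powRr1; apply: ltW; exact: s_gt0.
rewrite -copy_hsum (Lpnorm_copy _ p0) mulrAC sE mulrC; exact: lexx.
Qed.

Variable B : {set 'I_(2 ^ N)}.
Let u : R := #|B|%:R * s.

Lemma row_bound K : \sum_(L in B) `|a K L| <= s `^ q^-1 * t * u `^ p^-1.
Proof.
(* The test vector carries the signs of row [K] on [B] and is 0 elsewhere, so its p-norm is [u] to
   the power 1/p. *)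
pose c L : R := if L \in B then (if a K L < 0 then -1 else 1) else 0.
have -> : \sum_(L in B) `|a K L| = phi K c.
  rewrite phi_sum big_mkcond; apply: eq_bigr => L _; rewrite /c.
  case: ifP => _; last by rewrite mul0r.
  by case: ltP => a0; [rewrite ltr0_norm// mulN1r|rewrite ger0_norm// mul1r].
apply: le_trans (ler_norm _) _; apply: le_trans (phi_bound _ _) _.
rewrite Lpnorm_hsum//.
rewrite (_ : \sum_(K < 2 ^ N) `|c K| `^ p = #|B|%:R)//.
rewrite -sumr_const [RHS]big_mkcond; apply: eq_bigr => L _; rewrite /c.
case: ifP => _; last by rewrite normr0 powR0// gt_eqF.
by case: ifP => _; rewrite ?normrN normr1 powR1.
Qed.

Lemma sum_sqr_bound :
  \sum_(K in B) \sum_(L in B) a K L ^+ 2 <= t ^+ 2 * u `^ (p^-1 + 1) * s `^ q^-1.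
Proof.
have u0 : 0 <= u by rewrite mulr_ge0// ltW// s_gt0.
have t0 : 0 <= t := opnorm_ge0.
have s0 := s_gt0.
apply: le_trans (_ : \sum_(K in B) t * s * (s `^ q^-1 * t * u `^ p^-1) <= _).
  apply: ler_sum => K _.
  apply: le_trans (_ : t * s * \sum_(L in B) `|a K L| <= _); last first.
    by apply: ler_wpM2l; [rewrite mulr_ge0// ltW|exact: row_bound].
  rewrite mulr_sumr; apply: ler_sum => L _.
  by rewrite -real_normK ?num_real// expr2; apply: ler_wpM2r; rewrite ?entry_bound.
(* For empty [B] the base [u] is 0, so splitting the power is justified by the nonzero exponent 1/p
   + 1. *)
rewrite sumr_const -mulr_natl powRD; last first.
  by rewrite gt_eqF// addr_gt0// invr_gt0.
rewrite powRr1// le_eqVlt; apply/orP; left; apply/eqP.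
(* Only the free factor [u] is unfolded: it absorbs the cardinality of [B] and one factor [s]. *)
by rewrite {3}/u; ring.
Qed.

Lemma ip_hsum c : ip (hsum h M c) (T (hsum h M c)) = \sum_K \sum_L c K * c L * a K L.
Proof.
rewrite {1}/hsum (ip_suml p0 q0 pq); [|by move=> K; exact: inLp_copy|exact: inLp_T].
apply: eq_bigr => K _; rewrite -/(phi K c) phi_sum mulr_sumr.
by apply: eq_bigr => L _; rewrite mulrA.
Qed.

Lemma offdiagonal_form (th : {ffun 'I_(2 ^ N) -> bool}) :
  ip (fun x => \sum_(K in B) sgn R (th K) * h M N K x)
     (T (fun x => \sum_(K in B) sgn R (th K) * h M N K x))
    - \sum_(K in B) ip (h M N K) (T (h M N K)) =
  \sum_(v : 'I_(2 ^ N) * 'I_(2 ^ N) | [&& v.1 \in B, v.2 \in B & v.1 != v.2])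
     sgn R (th v.1) * sgn R (th v.2) * a v.1 v.2.
Proof.
pose c K := if K \in B then sgn R (th K) else 0.
have -> : (fun x => \sum_(K in B) sgn R (th K) * h M N K x) = hsum h M c.
  apply/funext => x; rewrite /hsum big_mkcond; apply: eq_bigr => K _.
  by rewrite /c; case: ifP => //; rewrite mul0r.
rewrite ip_hsum.
have -> : \sum_K \sum_L c K * c L * a K L =
    \sum_(K in B) \sum_(L in B) sgn R (th K) * sgn R (th L) * a K L.
  rewrite [RHS]big_mkcond; apply: eq_bigr => K _; rewrite /c.
  case: ifP => _; last by rewrite big1// => L _; rewrite !mul0r.
  rewrite [RHS]big_mkcond; apply: eq_bigr => L _; case: ifP => //.
  by rewrite mulr0 mul0r.
rewrite -sumrB.
rewrite -(pair_big_dep (mem B) (fun K L => (L \in B) && (K != L))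
  (fun K L => sgn R (th K) * sgn R (th L) * a K L)) /=.
(* The diagonal term has sign square 1 and cancels against the subtracted entry. *)
apply: eq_bigr => K KB; rewrite (bigD1 K)//= sgn_sqr mul1r addrAC subrr add0r.
by apply: eq_bigl => L; rewrite eq_sym.
Qed.

End Operator.

(** * Assembly of the chaos estimate and the entry bounds *)

Theorem mainTheorem7 (R : realType) (p : R) (h : nat -> nat -> nat -> R -> R)
    (T : (R -> R) -> (R -> R)) (M N : nat) (B : {set 'I_(2 ^ N)}) :
  1 < p ->
  haar_copies h ->
  bdd_lin_op p h T ->
  (N < M)%N ->
  let q := p / (p - 1) in
  (* {-1,1}^B : sign vectors indexed by B (theta K = true means -1) *)
  let Theta := finset (fun th : {ffun 'I_(2 ^ N) -> bool} => [forall K, (K \notin B) ==> ~~ th K]) in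
  let b := fun (th : {ffun 'I_(2 ^ N) -> bool}) (x : R) =>
             \sum_(K in B) sgn R (th K) * h M N K x in
  let Z := fun th => ip (b th) (T (b th)) - \sum_(K in B) ip (h M N K) (T (h M N K)) in
  umean Theta Z = 0 /\
  uvar Theta Z <= 2 * opnorm p h T ^+ 2
                  * (fine (lam (R:=R) (\bigcup_(K in [set K | K \in B]) dint (R:=R) N K))) `^ (p^-1 + 1)
                  * 2 `^ (- (N%:R / q)).
Proof.
move=> p1 hh Tlin NM q Theta b Z.
pose a (v : 'I_(2 ^ N) * 'I_(2 ^ N)) := ip (h M N v.1) (T (h M N v.2)).
have ZE : Z = fun th =>
    \sum_(v : 'I_(2 ^ N) * 'I_(2 ^ N) | [&& v.1 \in B, v.2 \in B & v.1 != v.2])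
      sgn R (th v.1) * sgn R (th v.2) * a v.
  by apply/funext => th; exact: (offdiagonal_form p1 hh Tlin NM B th).
have Z0 : umean Theta Z = 0 by rewrite ZE; exact: (umean_chaos B a).
split=> //.
rewrite /uvar Z0.
have -> : (fun th => (Z th - 0) ^+ 2) = (fun th => Z th ^+ 2).
  by apply/funext => th; rewrite subr0.
rewrite ZE; apply: le_trans (umean_chaos_sqr B a) _.
rewrite -!mulrA; apply: ler_wpM2l => //; rewrite !mulrA.
(* This is the factor [s] to the power 1/q of [sum_sqr_bound]. *)
have -> : 2 `^ (- (N%:R / q)) = ((2 ^ N)%:R)^-1 `^ q^-1 :> R.
  by rewrite -mulNr powRrM powRN powR_mulrn// natrX.
rewrite lam_bigcup_dint /=.
apply: le_trans (sum_sqr_bound p1 hh Tlin NM B).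
rewrite (pair_big (mem B) (mem B) (fun K L => ip (h M N K) (T (h M N L)) ^+ 2)) /=.
(* The full sum over pairs from [B] exceeds the off-diagonal one by the squares of the diagonal
   entries. *)
rewrite [leRHS](bigID (fun v => v.1 != v.2)) /=.
rewrite (eq_bigl (fun v => ((v.1 \in B) && (v.2 \in B)) && (v.1 != v.2))); last first.
  by move=> v; rewrite andbA.
by rewrite lerDl; apply: sumr_ge0 => v _; exact: sqr_ge0.
Qed.
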